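(* Let $Z$ be one-dimensional iterated Brownian motion and $g(t,x)=P_x(\tau_{(0,1)}(Z)>t)$ for $t>0$, $x\in(0,1)$. Then for every constant $a>0$, $g$ does not satisfy the equation $a\,\frac{\partial^4 g}{\partial x^4}=\frac{\partial g}{\partial t}$ on $(0,\infty)\times(0,1)$.
   Context: Let $X^+_t,X^-_t,Y_t$ be independent one-dimensional Brownian motions started at $0$; two-sided Brownian motion is $X_t=X^+_t$ for $t\ge0$, $X_t=X^-_{-t}$ for $t<0$; iterated Brownian motion started at $x$ is $Z_t=x+X(Y_t)$, with law $P_x$. For an open set $D$, $\tau_D(Z)=\inf\{t\ge0: Z_t\notin D\}$. *)

(* Defs.v *)
From HB Require Import structures.
From mathcomp Require Import all_boot all_order all_algebra.
From mathcomp Require Import all_classical all_reals all_analysis.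
Set Implicit Arguments. Unset Strict Implicit. Unset Printing Implicit Defensive.
Import Order.TTheory GRing.Theory Num.Theory.
Import numFieldNormedType.Exports.
Local Open Scope classical_set_scope.
Local Open Scope ring_scope.

Section ibm.
Context {d : measure_display} {T : measurableType d} {R : realType}
  (P : probability T R).

Definition indep_rvs (n : nat) (Xs : 'I_n -> T -> R) : Prop :=
  forall As : 'I_n -> set R, (forall i, measurable (As i)) ->
    P [set w | forall i, As i (Xs i w)] = (\prod_(i < n) P (Xs i @^-1` As i))%E.

(** One-dimensional standard Brownian motion started at 0, indexed by t >= 0
    (values of B at negative times are irrelevant). *)
Definition is_BM (B : R -> T -> R) : Prop :=
  [/\ (forall t, 0 <= t -> measurable_fun setT (B t)),
      (forall w, B 0 w = 0),
      (forall w, {within `[0, +oo[%classic, continuous (fun t => B t w)}),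
      (forall (n : nat) (ts : nat -> R), 0 <= ts 0%N ->
          (forall i, (i < n)%N -> ts i < ts i.+1) ->
          indep_rvs (fun (i : 'I_n) w => B (ts i.+1) w - B (ts i) w)) &
      (forall s t, 0 <= s -> s < t -> forall A, measurable A ->
          P ((fun w => B t w - B s w) @^-1` A) = normal_prob 0 (Num.sqrt (t - s)) A)].

Definition cyl (B : R -> T -> R) (n : nat) (ts : 'I_n -> R) (As : 'I_n -> set R)
  : set T := [set w | forall i, As i (B (ts i) w)].

Definition indep3 (B1 B2 B3 : R -> T -> R) : Prop :=
  forall (n1 n2 n3 : nat) (ts1 : 'I_n1 -> R) (ts2 : 'I_n2 -> R) (ts3 : 'I_n3 -> R)
    (As1 : 'I_n1 -> set R) (As2 : 'I_n2 -> set R) (As3 : 'I_n3 -> set R),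
    (forall i, 0 <= ts1 i) -> (forall i, 0 <= ts2 i) -> (forall i, 0 <= ts3 i) ->
    (forall i, measurable (As1 i)) -> (forall i, measurable (As2 i)) ->
    (forall i, measurable (As3 i)) ->
    P (cyl B1 ts1 As1 `&` cyl B2 ts2 As2 `&` cyl B3 ts3 As3) =
    (P (cyl B1 ts1 As1) * P (cyl B2 ts2 As2) * P (cyl B3 ts3 As3))%E.

Definition twosided (Xp Xm : R -> T -> R) (u : R) (w : T) : R :=
  if 0 <= u then Xp u w else Xm (- u) w.

Definition IBM (Xp Xm Y : R -> T -> R) (x t : R) (w : T) : R :=
  x + twosided Xp Xm (Y t w) w.

Definition exit_time (D : set R) (z : R -> R) : \bar R :=
  ereal_inf [set s%:E | s in [set s : R | 0 <= s /\ ~ D (z s)]].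

Definition ibm_survival (Xp Xm Y : R -> T -> R) (t x : R) : R :=
  fine (P [set w | (t%:E < exit_time `]0%R, 1%R[%classic (fun s => IBM Xp Xm Y x s w))%E]).

End ibm.

Definition satisfies_pde4 {R : realType} (a : R) (g : R -> R -> R) : Prop :=
  forall t x, 0 < t -> 0 < x < 1 ->
    [/\ derivable (fun s => g s x) t 1,
        (forall k, (k < 4)%N -> derivable (derive1n k (fun y => g t y)) x 1) &
        a * derive1n 4 (fun y => g t y) x = derive1 (fun s => g s x) t].

(* Main.v *)
Require Import Defs.
From HB Require Import structures.
From mathcomp Require Import all_boot all_order all_algebra.
From mathcomp Require Import all_classical all_reals all_analysis.
From mathcomp Require Import measurable_realfun fingroup perm zify ring lra.
Set Implicit Arguments. Unset Strict Implicit. Unset Printing Implicit Defensive.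
Import Order.TTheory GRing.Theory Num.Theory.
Import numFieldNormedType.Exports.
Local Open Scope classical_set_scope.
Local Open Scope ring_scope.

(* Fix [t] and put [f = g(t, .)]. Since [g] decreases in [t], the equation with
   [a > 0] forces [f^(4) <= 0]. Near an endpoint [f] is almost quadratically small:
   survival from [x] close to [0] forces both one-sided motions [Xp] and [Xm] to stay
   above [- x] over the range of [Y], unless [Y] itself hardly moves in some direction,
   and a Brownian motion stays above [- x] up to time [s] with probability
   [O(x / sqrt s)]. Hence [f] and its derivative vanish at both endpoints, and a
   nonnegative function with these clamped boundary conditions and [f^(4) <= 0] is
   zero: its divided difference at the nodes [e, 2e, 1/2, 1 - 2e, 1 - e] is
   nonpositive, and as [e] tends to [0] this gives [f(1/2) <= 0]. But [g(t, 1/2) > 0]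
   for small [t] by continuity of paths.
   The persistence bound comes from the position of the maximum of a symmetric random
   walk: if [p_n] is the probability that the first [n] partial sums are positive, the
   maximum is strict and at time [k] with probability [p_k * p_(n-k) >= p_n ^ 2], and
   summing over [k = 0 .. n] gives [(n + 1) * p_n ^ 2 <= 1]. *)

(** * Nonnegative functions with vanishing clamped data *)

(** Rolle between consecutive zeros of [h] gives one zero fewer for its derivative, in increasing
    order and inside the same interval; induction on [n] then applies to [derive1 h]. *)
Lemma iterated_Rolle {R : realType} (n : nat) (h : R -> R) (z : nat -> R) :
  (forall i, (i < n)%N -> z i < z i.+1) ->
  (forall i, (i <= n)%N -> h (z i) = 0) ->
  (forall k, (k < n)%N -> {in `[z 0%N, z n], forall x, derivable (derive1n k h) x 1}) ->
  exists2 c, c \in `[z 0%N, z n] & derive1n n h c = 0.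
Proof.
elim: n h z => [|n IH] h z zlt z0 dh.
  by exists (z 0%N); rewrite ?in_itv/= ?lexx// z0.
have zle m i j : (m <= n.+1)%N -> (i <= j <= m)%N -> z i <= z j.
  move=> mn; elim: j => [|j IHj]; first by rewrite leqn0 => /andP[/eqP ->].
  rewrite leq_eqVlt => /andP[/orP[/eqP ->//|ij] jm].
  rewrite (le_trans (IHj _))//; first by rewrite -ltnS ij ltnW.
  by rewrite ltW// zlt// (leq_trans jm).
have step i : (i <= n)%N ->
    exists c, z i < c < z i.+1 /\ derive1 h c = 0.
  move=> ni.
  have sub x : x \in `[z i, z i.+1] -> x \in `[z 0%N, z n.+1].
    rewrite !in_itv/= => /andP[zx xz]; apply/andP; split.
      by apply: le_trans zx; apply: (zle n.+1); rewrite ?leq0n //= (leq_trans ni).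
    by apply: (le_trans xz); apply: (zle n.+1); rewrite ?leqnn ?andbT.
  have [||||c cz dc] := @Rolle R h (z i) (z i.+1).
  - by rewrite zlt.
  - move=> x /subset_itv_oo_cc xz; have := dh 0%N isT x (sub _ xz).
    by rewrite derive1n0.
  - apply: derivable_within_continuous => x xz.
    by have := dh 0%N isT x (sub _ xz); rewrite derive1n0.
  - by rewrite !z0// ltnW.
  - exists c; split; first by move: cz; rewrite in_itv.
    by rewrite derive1E; exact: derive_val.
(* The new nodes form a function on all of [nat]; beyond [n] the value 0 is a filler. *)
have /boolp.choice[w Hw] : forall i, exists c, (i <= n)%N ->
    z i < c < z i.+1 /\ derive1 h c = 0.
  move=> i; case: (leqP i n) => [/step[c Hc]|ni]; first by exists c.
  by exists 0 => //; rewrite leqNgt ni.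
have wsub : {subset `[w 0%N, w n] <= `[z 0%N, z n.+1]}.
  move=> x; rewrite !in_itv/= => /andP[wx xw].
  have [/andP[? _] _] := Hw 0%N isT; have [/andP[_ ?] _] := Hw n (leqnn _).
  by apply/andP; split; lra.
have E k x : derive1n k (derive1 h) x = derive1n k.+1 h x.
  by rewrite /derive1n -iterSr.
have [|i ni|k kn x xw|c cw hc] := IH (derive1 h) w.
- move=> i ni; have [/andP[_ ?] _] := Hw i (ltnW ni).
  have [/andP[? _] _] := Hw i.+1 ni; lra.
- by have [] := Hw i ni.
- have -> : derive1n k (derive1 h) = derive1n k.+1 h by apply/funext => y; exact: E.
  by apply: dh => //; exact: wsub.
- by exists c; [exact: wsub|rewrite -E].
Qed.

(** The interval is open, so the identity at order [k] holds near each point and can be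
    differentiated once more. *)
Lemma derive1nB_horner {R : realType} (f : R -> R) (p : {poly R}) (a b : R) n :
  (forall k, (k < n)%N -> {in `]a, b[, forall x, derivable (derive1n k f) x 1}) ->
  forall k, (k <= n)%N -> {in `]a, b[, forall x,
    derive1n k (f \- horner p) x = derive1n k f x - p^`(k).[x]}.
Proof.
move=> df; elim=> [|k IH] kn x xab; first by rewrite !derive1n0 derivn0.
rewrite !derive1nS derivnS derivE !derive1E.
rewrite (@near_eq_derive _ _ _ _ (derive1n k f \- horner p^`(k))).
  by rewrite deriveB ?derive1E//; do ?exact: df.
near=> y; rewrite IH//; first exact: ltnW.
by near: y; exact: near_in_itvoo.
Unshelve. all: by end_near. Qed.

(* The quartic interpolating [f] at [z 0, .., z 4] has constant fourth
   derivative [24 * f[z 0, .., z 4]], and [f] minus this quartic has five zeros. *)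
Lemma divided_difference4 {R : realType} (f : R -> R) (a b : R) (z : nat -> R) :
  (forall k, (k < 4)%N -> {in `]a, b[, forall x, derivable (derive1n k f) x 1}) ->
  (forall i, (i < 4)%N -> z i < z i.+1) -> a < z 0%N -> z 4 < b ->
  exists2 c, c \in `]a, b[ & derive1n 4 f c =
    24 * \sum_(i < 5) f (z i) / \prod_(j < 5 | j != i) (z i - z j).
Proof.
move=> df zlt az zb.
have zneq (i j : 'I_5) : j != i -> z i - z j != 0.
  have zmono (m n : nat) : (m < n <= 4)%N -> z m < z n.
    elim: n => // n IHn /andP[]; rewrite ltnS leq_eqVlt.
    move=> /orP[/eqP <-|mn] n4; first exact: zlt.
    by rewrite (lt_trans (IHn _))// ?zlt// mn ltnW.
  move=> ji; rewrite subr_eq0; have := ltn_ord i; have := ltn_ord j.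
  rewrite !ltnS; case: (ltngtP i j) => [ij j4 _|ij _ i4|/val_inj ij].
  - by rewrite lt_eqF// zmono// ij.
  - by rewrite gt_eqF// zmono// ij.
  - by rewrite ij eqxx in ji.
pose P (i : 'I_5) : {poly R} := \prod_(j < 5 | j != i) ('X - (z j)%:P).
pose w (i : 'I_5) := \prod_(j < 5 | j != i) (z i - z j).
pose p : {poly R} := \sum_(i < 5) (f (z i) / w i) *: P i.
have w0 i : w i != 0 by apply/prodf_neq0 => j; exact: zneq.
have pz (i : 'I_5) : p.[z i] = f (z i).
  rewrite horner_sum (bigD1 i)//= big1 ?addr0.
    rewrite hornerZ horner_prod -[RHS](divfK (w0 i)); congr (_ * _).
    by apply: eq_bigr => j _; rewrite !hornerE.
  move=> j ji; rewrite hornerZ horner_prod (bigD1 i) 1?eq_sym//=.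
  by rewrite hornerXsubC subrr mul0r mulr0.
(* Each [P i] is monic of degree 4, so its fourth derivative is the constant 4! = 24. *)
have P4 i : (P i)^`(4) = 24%:P.
  have mP : P i \is monic by apply: monic_prod => j _; exact: monicXsubC.
  have sP : size (P i) = 5.
    rewrite /P -big_filter size_prod_XsubC size_filter -sum1_count.
    by rewrite sum1_card cardC1 card_ord.
  apply/polyP => k; rewrite coef_derivn coefC; case: k => [|k].
    by move/monicP: mP; rewrite lead_coefE sP addn0 => ->.
  by rewrite nth_default ?mul0rn// sP addnS ltnS leq_addr.
have p4 : p^`(4) = (24 * \sum_(i < 5) f (z i) / w i)%:P.
  rewrite /p (linear_sum (derivn 4)) mulr_sumr rmorph_sum; apply: eq_bigr => i _.
  by rewrite [LHS]derivnZ P4 -mul_polyC -polyCM mulrC.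
have zab x : x \in `[z 0%N, z 4] -> x \in `]a, b[.
  by rewrite !in_itv/= => /andP[? ?]; apply/andP; split; lra.
have [| | |c cz hc] := @iterated_Rolle R 4 (f \- horner p) z.
- exact: zlt.
- by move=> i i4 /=; have -> := pz (Ordinal (i4 : (i < 5)%N)); rewrite subrr.
- move=> k k4 x /zab xab.
  apply: (@near_eq_derivable _ _ _ (derive1n k f \- horner p^`(k))).
    near=> y; rewrite (@derive1nB_horner _ f p a b 4)//; first exact: ltnW.
    by near: y; exact: near_in_itvoo.
  by apply: derivableB; [exact: df|exact: derivable_horner].
exists c; first exact: zab.
move: hc; rewrite (@derive1nB_horner _ _ _ a b 4)//; last exact: zab.
by rewrite p4 hornerC => /eqP; rewrite subr_eq0 => /eqP.
Unshelve. all: by end_near. Qed.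

Lemma nonincreasing_derive1_le0 {R : realType} (f : R -> R) (a z : R) :
  {in `]a, +oo[, forall x, derivable f x 1} ->
  (forall x y, a < x -> x <= y -> f y <= f x) -> a < z -> derive1 f z <= 0.
Proof.
move=> df f_ni az; rewrite leNgt; apply/negP => fz.
(* Subtracting a line of slope [e] turns weak into strict monotonicity, as [decr_derive1_le0_itvy]
   requires, and leaves the slope [e > 0] at [z]. *)
pose e : R := derive1 f z / 2.
pose h : R -> R := f \- (fun x => e * x).
have dl (x : R) : derivable ( *%R e) x 1 by apply: (@derivableM _ _ (cst e) id); [exact: derivable_cst|exact: derivable_id].
have zay : z \in `]a, +oo[ by rewrite in_itv/= az.
have : derive1 h z <= 0.
  apply: (@decr_derive1_le0_itvy _ h false a) => //.
    by move=> x /set_mem xa; apply: derivableB; [exact: df|exact: dl].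
  move=> x y; rewrite !in_itv/= !andbT => ax ay yx.
  have := f_ni y x ay (ltW yx); rewrite /h /=.
  have : 0 < e * (x - y) by rewrite mulr_gt0 ?subr_gt0// divr_gt0.
  by rewrite mulrBr; lra.
rewrite derive1E deriveB; [|exact: df|exact: dl].
rewrite deriveM// derive_cst derive_id scaler0 addr0 -derive1E.
by rewrite /e /GRing.scale/= mulr1; lra.
Qed.

(** At distance [b = y ^+ 4] from an endpoint the bound reads [f = O(b^(5/4))]: it is superlinear in
    [b], which encodes the vanishing of [f] and of its derivative there, and the powers of [y] avoid
    real exponents. In the divided difference the two outermost nodes have positive weights, the
    nodes [b] and [1 - b] contribute at least [- 8 * K * y] each, and the middle one at least
    [16 * f (1 / 2)]. *)
Lemma clamped_le0 {R : realType} (f : R -> R) (K : R) :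
  (forall k, (k < 4)%N -> {in `]0, 1[, forall x, derivable (derive1n k f) x 1}) ->
  {in `]0, 1[, forall x, derive1n 4 f x <= 0} ->
  {in `]0, 1[, forall x, 0 <= f x} ->
  (forall y : R, 0 < y <= 1 / 2 -> f (y ^+ 4) <= K * y ^+ 5) ->
  (forall y : R, 0 < y <= 1 / 2 -> f (1 - y ^+ 4) <= K * y ^+ 5) ->
  f (1 / 2) <= 0.
Proof.
move=> df d4 f0 fl fr.
have key (y : R) : 0 < y <= 1 / 2 -> f (1 / 2) <= K * y.
  move=> y12; have /andP[y0 y2] := y12.
  pose b : R := y ^+ 4.
  have b0 : 0 < b by rewrite exprn_gt0.
  have b1 : b <= 1 / 16.
    have -> : 1 / 16 = (1 / 2) ^+ 4 :> R by field.
    by rewrite lerXn2r// nnegrE; lra.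
  pose z i : R := nth 0 [:: b / 2; b; 1 / 2; 1 - b; 1 - b / 2] i.
  have [| | |c c01] := @divided_difference4 R f 0 1 z df.
  - by do 4 (case=> [_|]; first by rewrite /z/=; lra).
  - by rewrite /z/=; lra.
  - by rewrite /z/=; lra.
  have := d4 c c01 => /[swap] -> {c c01}.
  (* An unconditional product over five indices can be unfolded factor by factor. *)
  have prodE (i : 'I_5) (F : 'I_5 -> R) : \prod_(j < 5 | j != i) F j =
      \prod_(j < 5) (if j == i then 1 else F j).
    by rewrite big_mkcond; apply: eq_bigr => j _; case: eqP.
  set goal := (f (1 / 2) <= K * y).
  rewrite pmulr_rle0 ?ltr0n//; under eq_bigr do rewrite prodE.
  rewrite !(big_ord_recl, big_ord0) /= !(mul1r, mulr1, addr0) /z /=.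
  set w0 := (X in f (b / 2) / X); set w1 := (X in f b / X).
  set w2 := (X in f (1 / 2) / X); set w3 := (X in f (1 - b) / X).
  set w4 := (X in f (1 - b / 2) / X).
  have w0_gt0 : 0 < w0 by rewrite /w0; nra.
  have w4_gt0 : 0 < w4 by rewrite /w4; nra.
  have q : 1 / 4 <= (1 / 2 - b) * ((1 - 2 * b) * (1 - 3 * b / 2)) by nra.
  have w1E : - w1 = b / 2 * ((1 / 2 - b) * ((1 - 2 * b) * (1 - 3 * b / 2))).
    by rewrite /w1; field.
  have w3E : - w3 = b / 2 * ((1 / 2 - b) * ((1 - 2 * b) * (1 - 3 * b / 2))).
    by rewrite /w3; field.
  have w1_ge : b / 8 <= - w1 by rewrite w1E; clear -b0 q; nra.
  have w3_ge : b / 8 <= - w3 by rewrite w3E; clear -b0 q; nra.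
  have w2_gt0 : 0 < w2.
    have -> : w2 = ((1 / 2 - b) * (1 / 2 - b / 2)) ^+ 2 by rewrite /w2; field.
    apply: exprn_gt0; apply: mulr_gt0; lra.
  have w2_le : w2 <= 1 / 16.
    have -> : w2 = ((1 / 2 - b) * (1 / 2 - b / 2)) ^+ 2 by rewrite /w2; field.
    have t1 : (1 / 2 - b) * (1 / 2 - b / 2) <= 1 / 4 by nra.
    have t0 : 0 <= (1 / 2 - b) * (1 / 2 - b / 2) by apply: mulr_ge0; lra.
    by rewrite expr2; clear -t0 t1; nra.
  have f01 (x : R) : 0 < x -> x < 1 -> 0 <= f x.
    by move=> x0 x1; apply: f0; rewrite in_itv/= x0.
  (* Weights of order [b] are harmless here, because [K * y ^+ 5 = K * y * b] has a factor [y] to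
     spare. *)
  have side (x w : R) : 0 <= f x -> f x <= K * y ^+ 5 -> b / 8 <= - w ->
      - (8 * K * y) <= f x / w.
    move=> fx0 fxK wb; rewrite -[f x / w]opprK lerN2 -mulrN -invrN.
    rewrite ler_pdivrMr; last lra.
    have yb : K * y ^+ 5 = K * y * b by rewrite /b; ring.
    have Ky0 : 0 <= K * y by rewrite -(pmulr_lge0 _ b0) -yb; lra.
    by rewrite -mulrA; nra.
  have h0 : 0 <= f (b / 2) / w0 by apply: divr_ge0; [apply: f01; lra|exact: ltW].
  have h4 : 0 <= f (1 - b / 2) / w4 by apply: divr_ge0; [apply: f01; lra|exact: ltW].
  have h1 : - (8 * K * y) <= f b / w1.
    by apply: side => //; [apply: f01; lra|exact: fl].
  have h3 : - (8 * K * y) <= f (1 - b) / w3.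
    by apply: side => //; [apply: f01; lra|exact: fr].
  have h2 : 16 * f (1 / 2) <= f (1 / 2) / w2.
    rewrite ler_pdivlMr//.
    by have : 0 <= f (1 / 2) by [apply: f01; lra]; nra.
  rewrite /goal => le0; lra.
rewrite leNgt; apply/negP => fp.
have K0 : 0 < K.
  by have := key (1 / 2); rewrite lexx andbT => /(_ ltac:(lra)); nra.
have fK : 0 < f (1 / 2) / (2 * K) by rewrite divr_gt0// mulr_gt0.
(* This [y] makes [K * y] at most half of [f (1 / 2)], against [key]. *)
pose y : R := Num.min (1 / 2) (f (1 / 2) / (2 * K)).
have /key : 0 < y <= 1 / 2 by rewrite /y lt_min fK ge_min lexx andbT; lra.
have : K * y <= f (1 / 2) / 2.
  rewrite -ler_pdivlMl// (_ : K^-1 * _ = f (1 / 2) / (2 * K)); last by field; lra.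
  by rewrite /y ge_min lexx orbT.
lra.
Qed.

(** * Independent identically distributed families *)

(** Boxes, unlike the one-coordinate cylinders that generate the same sigma-algebra, are stable
    under intersection, as uniqueness of measures demands. *)
Lemma measurable_tuple_boxes (R : realType) n :
  (@measurable _ (n.-tuple R)) = <<s [set B | exists As : 'I_n -> set R,
    (forall i, measurable (As i)) /\ B = [set u | forall i, As i (tnth u i)]] >>.
Proof.
apply/seteqP; split.
  apply: smallest_sub; first exact: smallest_sigma_algebra.
  move=> B; rewrite -bigcup_seq => -[i _ [A mA <-]]; apply: sub_sigma_algebra.
  exists (fun j => if j == i then A else setT); split=> [j|]; first by case: ifP.
  rewrite setTI; apply/seteqP; split=> u /= Au => [j|].
    by case: eqP => // ->.
  by have := Au i; rewrite eqxx.
apply: smallest_sub; first exact: sigma_algebra_measurable.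
move=> B [As [mAs ->]].
rewrite (_ : [set u | _] = \bigcap_(i in [set: 'I_n]) ((@tnth _ R ^~ i) @^-1` As i)).
  apply: fin_bigcap_measurable => // i _.
  rewrite -[X in measurable X]setTI.
  exact: (measurable_tnth i measurableT (mAs i)).
apply/seteqP; split=> u /= Au i; [move=> _; exact: Au|exact: (Au i)].
Qed.

Lemma eq_law_tuple (d1 d2 : measure_display) (T1 : measurableType d1)
  (T2 : measurableType d2) (R : realType) (P1 : probability T1 R)
  (P2 : probability T2 R) n (X1 : T1 -> n.-tuple R)
  (X2 : T2 -> n.-tuple R) :
  measurable_fun setT X1 -> measurable_fun setT X2 ->
  (forall As : 'I_n -> set R, (forall i, measurable (As i)) ->
    P1 [set w | forall i, As i (tnth (X1 w) i)] =
    P2 [set w | forall i, As i (tnth (X2 w) i)]) ->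
  forall C, measurable C -> P1 (X1 @^-1` C) = P2 (X2 @^-1` C).
Proof.
move=> mX1 mX2 X12 C mC.
pose m1 : set _ -> \bar R := pushforward P1 X1.
pose m2 : set _ -> \bar R := pushforward P2 X2.
rewrite -[LHS]/(m1 C) -[RHS]/(m2 C).
apply: (@measure_unique _ _ _ _ (fun=> setT) (measurable_tuple_boxes R n)) => //.
- move=> _ _ [As [mAs ->]] [Bs [mBs ->]]; exists (fun i => As i `&` Bs i).
  split=> [i|]; first exact: measurableI.
  apply/seteqP; split=> u /= => [[uA uB] i|uAB]; first by split.
  by split=> i; have [] := uAB i.
- move=> _; exists (fun=> setT); split=> //.
  by apply/seteqP; split.
- by rewrite bigcup_const.
- by move=> _ [As [mAs ->]]; exact: X12.
- by move=> _; rewrite /= /pushforward preimage_setT probability_setT ltry.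
Qed.

(** The product formula on boxes expresses independence and the common law [nu] at once. Indexing by
    [nat] lets partial sums be written without ordinals; only the first [n] variables are
    constrained. *)
Definition iid {d} {T : measurableType d} {R : realType} (P : probability T R)
    (nu : probability (measurableTypeR R) R) (n : nat) (X : nat -> T -> R) : Prop :=
  (forall i, (i < n)%N -> measurable_fun setT (X i)) /\
  forall As : 'I_n -> set R, (forall i, measurable (As i)) ->
    P [set w | forall i : 'I_n, As i (X i w)] = (\prod_(i < n) nu (As i))%E.

Lemma measurable_rectangle {d} {T : measurableType d} {R : realType} n
    (X : 'I_n -> T -> R) (As : 'I_n -> set R) :
  (forall i, measurable_fun setT (X i)) -> (forall i, measurable (As i)) ->
  measurable [set w | forall i, As i (X i w)].
Proof.
move=> mX mAs.
rewrite (_ : [set w | _] = \bigcap_(i in [set: 'I_n]) (X i @^-1` As i)).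
  apply: fin_bigcap_measurable => // i _.
  by rewrite -[X in measurable X]setTI; exact: mX.
by apply/seteqP; split=> u /= Au i; [move=> _; exact: Au|exact: (Au i)].
Qed.

Section iid.
Context {d1 d2 : measure_display} {T1 : measurableType d1}
  {T2 : measurableType d2} {R : realType} (P1 : probability T1 R)
  (P2 : probability T2 R) (nu : probability (measurableTypeR R) R) (n : nat).

(** This allows a walk to be exchanged for a permuted, reflected or glued one living on another
    probability space. *)
Lemma eq_law_iid (X1 : nat -> T1 -> R) (X2 : nat -> T2 -> R) :
  iid P1 nu n X1 -> iid P2 nu n X2 ->
  forall C : set (n.-tuple R), measurable C ->
    P1 [set w | C [tuple X1 i w | i < n]] = P2 [set w | C [tuple X2 i w | i < n]].
Proof.
move=> [mX1 iX1] [mX2 iX2]; apply: eq_law_tuple.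
- apply/measurable_fun_tnthP => i; rewrite (_ : _ \o _ = X1 i); first exact: mX1.
  by apply/funext => w /=; rewrite tnth_mktuple.
- apply/measurable_fun_tnthP => i; rewrite (_ : _ \o _ = X2 i); first exact: mX2.
  by apply/funext => w /=; rewrite tnth_mktuple.
- move=> As mAs; transitivity (P1 [set w | forall i : 'I_n, As i (X1 i w)]).
    by congr (P1 _); apply/seteqP; split=> w /= Xw i; have := Xw i;
      rewrite tnth_mktuple.
  rewrite iX1// -iX2//; congr (P2 _); apply/seteqP; split=> w /= Xw i; have := Xw i;
      by rewrite tnth_mktuple.
Qed.

Lemma iid_perm (s : {perm 'I_n}) (X Y : nat -> T1 -> R) :
  iid P1 nu n X -> (forall i : 'I_n, Y i = X (s i)) -> iid P1 nu n Y.
Proof.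
move=> [mX iX] YX; split=> [i ni|As mAs].
  by rewrite (YX (Ordinal ni)); exact: mX.
rewrite (reindex_inj (@perm_inj _ s^-1%g)) -iX => [|i]; last exact: mAs.
congr (P1 _); apply/seteqP; split=> w /= Xw i.
- by have := Xw ((s^-1)%g i); rewrite YX permKV.
- by have := Xw (s i); rewrite YX permK.
Qed.

Lemma iidN (X : nat -> T1 -> R) :
  (forall A : set R, measurable A -> nu (-%R @^-1` A) = nu A) ->
  iid P1 nu n X -> iid P1 nu n (fun i w => - X i w).
Proof.
move=> nuN [mX iX]; split=> [i ni|As mAs].
  by apply: measurable_funN; exact: mX.
under eq_bigr do rewrite -nuN//.
rewrite -iX// => i; rewrite -[X in measurable X]setTI.
by apply: (@oppr_measurable R setT) => //.
Qed.

(** On the product space the box event is a product of two boxes. A coordinate not read from a copy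
    has the full line as its side there and contributes the factor 1. *)
Lemma iid_mix (b : nat -> bool) (X1 : nat -> T1 -> R) (X2 : nat -> T2 -> R) :
  iid P1 nu n X1 -> iid P2 nu n X2 ->
  iid (P1 \x P2)%E nu n (fun i w => if b i then X1 i w.1 else X2 i w.2).
Proof.
move=> [mX1 iX1] [mX2 iX2]; split=> [i ni|As mAs].
  case: (b i).
  - by apply: measurableT_comp => //; exact: mX1.
  - by apply: measurableT_comp => //; exact: mX2.
pose A1 (i : 'I_n) := if b i then As i else setT.
pose A2 (i : 'I_n) := if b i then setT else As i.
have mA1 i : measurable (A1 i) by rewrite /A1; case: ifP.
have mA2 i : measurable (A2 i) by rewrite /A2; case: ifP.
rewrite (_ : [set _ | _] = [set w | forall i : 'I_n, A1 i (X1 i w)] `*`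
                           [set w | forall i : 'I_n, A2 i (X2 i w)]); last first.
  rewrite /A1 /A2; apply/seteqP; split=> -[w1 w2] /=.
    by move=> Aw; split=> i; have := Aw i; case: ifP.
  by move=> [Aw1 Aw2] i; have := Aw1 i; have := Aw2 i; case: ifP.
rewrite [LHS]product_measure1E; first last.
- by apply: (measurable_rectangle (X := X2)) => // i; exact: mX2.
- by apply: (measurable_rectangle (X := X1)) => // i; exact: mX1.
rewrite [X in (X * _)%E](iX1 A1 mA1) [X in (_ * X)%E](iX2 A2 mA2) -big_split/=.
apply: eq_bigr => i _; rewrite /A1 /A2.
by case: ifP => _; rewrite probability_setT ?mule1 ?mul1e.
Qed.
End iid.

(** * Persistence of symmetric random walks *)

Lemma reverse_prefix_perm n k : (k <= n)%N ->
  exists s : {perm 'I_n}, forall i : 'I_n,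
    s i = (if (i < k)%N then (k - i.+1)%N else i) :> nat.
Proof.
move=> kn.
have lt (i : 'I_n) : ((if (i < k)%N then k - i.+1 else i) < n)%N.
  by case: ifP => // ik; rewrite (leq_trans _ kn)// ltn_subrL// (leq_ltn_trans _ ik).
have inj : injective (fun i => Ordinal (lt i)).
  move=> i j /(congr1 val)/=; case: ifP => ik; case: ifP => jk ij; apply/val_inj => /=; lia.
by exists (perm inj) => i; rewrite permE.
Qed.

(** The indices below [k] are moved to the end only to obtain a bijection; their images are never
    consulted. *)
Lemma rotation_perm n k : (k <= n)%N ->
  exists s : {perm 'I_n}, forall i : 'I_n, (k <= i)%N -> s i = (i - k)%N :> nat.
Proof.
move=> kn.
have lt (i : 'I_n) : ((if (k <= i)%N then i - k else i + (n - k)) < n)%N.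
  by have := ltn_ord i; case: ifP; lia.
have inj : injective (fun i => Ordinal (lt i)).
  move=> i j /(congr1 val)/=; have := ltn_ord i; have := ltn_ord j.
  by case: ifP => ik; case: ifP => jk ? ? ij; apply/val_inj => /=; lia.
by exists (perm inj) => i ki; rewrite permE/= ki.
Qed.

Lemma measurable_nat_sum {d} {T : measurableType d} {R : realType}
    (X : nat -> T -> R) n :
  (forall i, (i < n)%N -> measurable_fun setT (X i)) ->
  forall j, (j <= n)%N -> measurable_fun setT (fun w => \sum_(0 <= i < j) X i w).
Proof.
move=> mX; elim=> [|j IH] jn.
  by under eq_fun do rewrite big_geq//; exact: measurable_cst.
under eq_fun do rewrite big_nat_recr//=.
by apply: measurable_funD; [exact/IH/ltnW|exact: mX].
Qed.

Lemma measurable_tuple_preimage {d} {T : measurableType d} {R : realType} n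
    (X : nat -> T -> R) (D : set (n.-tuple R)) :
  (forall i, (i < n)%N -> measurable_fun setT (X i)) -> measurable D ->
  measurable [set w | D [tuple X i w | i < n]].
Proof.
move=> mX mD; have mt : measurable_fun setT (fun w => [tuple X i w | i < n]).
  apply/measurable_fun_tnthP => i; rewrite (_ : _ \o _ = X i); first exact: mX.
  by apply/funext => w /=; rewrite tnth_mktuple.
by rewrite -[X in measurable X]setTI; exact: mt.
Qed.

(** Before time [k] the sum of [v] from [j] to [k], read backwards, is the partial sum of [x] of
    length [k - j]; after time [k] the increment from [k] to [j] is minus the partial sum of [y] of
    length [j - k]. *)
Lemma glued_walk_argmax {R : realDomainType} (x y v : nat -> R) n k : (k <= n)%N ->
  (forall j, (0 < j <= n)%N -> 0 < \sum_(0 <= i < j) x i) ->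
  (forall j, (0 < j <= n)%N -> 0 < \sum_(0 <= i < j) y i) ->
  (forall i, (i < n)%N -> v i = if (i < k)%N then x (k - i.+1)%N else - y (i - k)%N) ->
  forall j, (j <= n)%N -> j != k -> \sum_(0 <= i < j) v i < \sum_(0 <= i < k) v i.
Proof.
move=> kn x0 y0 vE j jn jk.
have [jk'|kj|jk'] := ltngtP j k; last by rewrite jk' eqxx in jk.
- have jk2 := ltnW jk'.
  rewrite (big_cat_nat (leq0n j) jk2)/= ltrDl big_nat_rev/=.
  rewrite -{1}[j]add0n big_addn.
  rewrite (eq_big_nat _ _ (F2 := x)); first by apply: x0; lia.
  move=> i ij; rewrite vE; last by lia.
  by rewrite ifT; [congr (x _); lia|lia].
- have kj2 := ltnW kj.
  rewrite (big_cat_nat (leq0n k) kj2)/= gtrDl.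
  rewrite -{1}[k]add0n big_addn.
  rewrite (eq_big_nat _ _ (F2 := fun i => - y i)).
    by rewrite sumrN oppr_lt0; apply: y0; lia.
  move=> i ij; rewrite vE; last by lia.
  by rewrite ifF; [congr (- y _); lia|lia].
Qed.

Definition above {T : Type} {R : realType} (x : R) (X : nat -> T -> R) n : set T :=
  [set w | forall j, (0 < j <= n)%N -> x < \sum_(0 <= i < j) X i w].

Lemma measurable_above {d} {T : measurableType d} {R : realType} (x : R)
    (X : nat -> T -> R) n :
  (forall i, (i < n)%N -> measurable_fun setT (X i)) -> measurable (above x X n).
Proof.
move=> mX; rewrite (_ : above x X n = \bigcap_(j in [set j | (0 < j <= n)%N])
    ((fun w => \sum_(0 <= i < j) X i w) @^-1` `]x, +oo[)); last first.
  apply/seteqP; split=> w /= H j jn; have := H j jn; by rewrite /= in_itv/= andbT.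
apply: bigcap_measurableType => j /andP[_ jn].
rewrite -[X in measurable X]setTI.
by apply: (measurable_nat_sum mX jn) => //; exact: measurable_itv.
Qed.

Lemma sum_tuple_nth {T : Type} {R : realType} (X : nat -> T -> R) n w j : (j <= n)%N ->
  \sum_(0 <= i < j) [tuple X i w | i < n]`_i = \sum_(0 <= i < j) X i w.
Proof.
move=> jn; apply: eq_big_nat => i /andP[_ ij].
by rewrite (nth_mktuple _ _ (Ordinal (leq_trans ij jn))).
Qed.

Lemma measurable_tuple_nth {R : realType} n i :
  measurable_fun setT (fun u : n.-tuple R => u`_i).
Proof.
case: (ltnP i n) => ni.
  rewrite (_ : (fun _ => _) = @tnth _ R ^~ (Ordinal ni)); first exact: measurable_tnth.
  by apply/funext => u; rewrite (tnth_nth 0).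
rewrite (_ : (fun _ => _) = cst 0)//.
by apply/funext => u; rewrite nth_default// size_tuple.
Qed.

Section persistence.
Context {d : measure_display} {T : measurableType d} {R : realType}
  (P : probability T R) (nu : probability (measurableTypeR R) R).

(** The event that the walk has its strict maximum at time [k], stated on tuples so that
    [eq_law_iid] can carry its probability from one walk to another. *)
Let C n k := [set u : n.-tuple R | forall j, (j <= n)%N -> j != k ->
  \sum_(0 <= i < j) u`_i < \sum_(0 <= i < k) u`_i].

Let measurable_C n k : measurable (@C n k).
Proof.
have ms j : measurable_fun setT (fun u : n.-tuple R => \sum_(0 <= i < j) u`_i).
  by apply: (@measurable_nat_sum _ _ _ (fun i (u : n.-tuple R) => u`_i) j) => // i _; exact: measurable_tuple_nth.
rewrite (_ : @C n k = \bigcap_(j in [set j | (j <= n)%N && (j != k)])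
    [set u : n.-tuple R | \sum_(0 <= i < j) u`_i < \sum_(0 <= i < k) u`_i]).
  apply: bigcap_measurableType => j _.
  rewrite (_ : mkset _ = setT `&` ((fun u : n.-tuple R => \sum_(0 <= i < k) u`_i) \-
      (fun u => \sum_(0 <= i < j) u`_i)) @^-1` `]0, +oo[).
    by apply: measurable_funB => //; exact: measurable_itv.
  by rewrite setTI; apply/seteqP; split=> u; rewrite /= in_itv/= andbT subr_gt0.
by apply/seteqP; split=> u /= H j; [move=> /andP[]; exact: H|
  move=> jn jk; apply: (H j); rewrite /= jn].
Qed.


Let CE d' (T' : measurableType d') (X : nat -> T' -> R) n k w : (k <= n)%N ->
  C k [tuple X i w | i < n] <-> forall j, (j <= n)%N -> j != k ->
    \sum_(0 <= i < j) X i w < \sum_(0 <= i < k) X i w.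
Proof.
by move=> kn; split=> H j jn jk; have := H j jn jk; rewrite !sum_tuple_nth.
Qed.

(* The walk is glued from the time reversal of the first copy up to time [k] and
   the opposite of the second copy after time [k]. If both copies stay positive,
   the glued walk has its strict maximum at time [k]. *)
Let argmax_ge X n k : iid P nu n X ->
  (forall A : set R, measurable A -> nu (-%R @^-1` A) = nu A) -> (k <= n)%N ->
  (P (above 0 X n) * P (above 0 X n) <= P [set w | C k [tuple X i w | i < n]])%E.
Proof.
move=> iX nuN kn; have [mX _] := iX.
have [s sE] := reverse_prefix_perm kn; have [r rE] := rotation_perm kn.
pose X1 i := X (if (i < k)%N then (k - i.+1)%N else i).
(* The permutation [r] is extended to [nat] by 0; for [k <= i < n] this is the step of index
   [i - k]. *)
pose X2 i := X (oapp (fun j : 'I_n => nat_of_ord (r j)) 0%N (insub i)).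
have iX1 : iid P nu n X1.
  by apply: (iid_perm (s := s) iX) => i; rewrite sE.
have iX2 : iid P nu n X2.
  by apply: (iid_perm (s := r) iX) => i; rewrite /X2 valK.
pose V i (w : T * T) := if (i < k)%N then X1 i w.1 else - X2 i w.2.
have iV : iid (P \x P)%E nu n V.
  exact: (iid_mix (fun i => (i < k)%N) iX1 (iidN nuN iX2)).
rewrite (eq_law_iid iX iV); last exact: measurable_C.
rewrite -product_measure1E; [|exact: measurable_above..].
apply: le_measure.
- by apply: mem_set; apply: measurableX (measurable_above 0 mX) (measurable_above 0 mX).
- apply: mem_set; apply: measurable_tuple_preimage; [exact: iV.1|exact: measurable_C].
move=> [w1 w2] [/= W1 W2]; apply/(CE V (w1, w2) kn) => j jn jk.
apply: (glued_walk_argmax kn W1 W2) jn jk => i ni; rewrite /V.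
case: ifP => ik; first by rewrite /X1 ik.
rewrite /X2 (insubT (fun i => (i < n)%N) ni)/= rE//=.
by rewrite leqNgt ik.
Qed.

Lemma persistence_iid X n : iid P nu n X ->
  (forall A : set R, measurable A -> nu (-%R @^-1` A) = nu A) ->
  ((n.+1%:R)%:E * (P (above 0 X n) * P (above 0 X n)) <= 1)%E.
Proof.
move=> iX nuN; pose A (k : 'I_n.+1) := [set w | C k [tuple X i w | i < n]].
have mA k : measurable (A k).
  by apply: measurable_tuple_preimage; [exact: iX.1|exact: measurable_C].
have tA : trivIset setT A.
  apply/trivIsetP => i j _ _ ij; apply/seteqP; split=> // w [].
  have [ni nj] : (i <= n)%N /\ (j <= n)%N by split; rewrite -ltnS ltn_ord.
  move=> /(CE _ _ ni) Ai /(CE _ _ nj) Aj.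
  have ji : j != i :> nat by rewrite eq_sym.
  by have := lt_trans (Ai j nj ji) (Aj i ni ij); rewrite ltxx.
apply: (@le_trans _ _ (P (\big[setU/set0]_(k < n.+1) A k))); last first.
  by apply: probability_le1; exact: bigsetU_measurable.
rewrite measure_bigsetU_ord//.
apply: (@le_trans _ _ (\sum_(k < n.+1) (P (above 0 X n) * P (above 0 X n)))%E).
  by rewrite big_const_ord -Monoid.iteropE mule_natl.
apply: lee_sum => k _; apply: argmax_ge => //; exact: (ltn_ord k).
Qed.

(** If a first step exceeds [x] and an independent walk of [n] steps stays above [- x], their
    concatenation stays positive for [n.+1] steps. *)
Lemma above_shift X n x : 0 <= x -> iid P nu n.+1 X ->
  (nu `]x, +oo[%classic * P (above (- x) X n) <= P (above 0 X n.+1))%E.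
Proof.
move=> x0 iX; have [mX iXE] := iX.
(* Rotating by one puts steps [0 .. n - 1] of the second copy at indices [1 .. n], behind the first
   step of the first copy. *)
have [r rE] := rotation_perm (isT : (1 <= n.+1)%N).
pose X2 i := X (oapp (fun j : 'I_n.+1 => nat_of_ord (r j)) 0%N (insub i)).
have iX2 : iid P nu n.+1 X2.
  by apply: (iid_perm (s := r) iX) => i; rewrite /X2 valK.
pose V i (w : T * T) := if (i < 1)%N then X i w.1 else X2 i w.2.
have iV : iid (P \x P)%E nu n.+1 V.
  exact: (iid_mix (fun i => (i < 1)%N) iX iX2).
have -> : nu `]x, +oo[%classic = P (X 0%N @^-1` `]x, +oo[).
  pose As (i : 'I_n.+1) : set R := if i == ord0 then `]x, +oo[%classic else setT.
  have := iXE As; rewrite big_ord_recl/= big1 ?mule1.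
    move=> <-; last by move=> i; rewrite /As; case: ifP.
    congr (P _); apply/seteqP; split=> w /=; first by move/(_ ord0); rewrite /As eqxx.
    by move=> Xw i; rewrite /As; case: eqP => // ->.
  by move=> i _; rewrite /As/= probability_setT.
pose D := above 0 (fun i (u : n.+1.-tuple R) => u`_i) n.+1.
have mD : measurable D.
  by apply: measurable_above => i ni; exact: measurable_tuple_nth.
have aD d' (T' : measurableType d') (Y : nat -> T' -> R) :
    above 0 Y n.+1 = [set w | D [tuple Y i w | i < n.+1]].
  apply/seteqP; split=> w H j jn; have := H j jn; rewrite sum_tuple_nth//;
    by case/andP: jn.
rewrite (aD _ _ X) (eq_law_iid iX iV)// -aD.
have mX0 : measurable (X 0%N @^-1` `]x, +oo[).
  by rewrite -[X in measurable X]setTI; apply: mX => //; exact: measurable_itv.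
have mA : measurable (above (- x) X n).
  by apply: measurable_above => i ni; apply: mX; exact: ltnW.
rewrite -product_measure1E//; apply: le_measure.
- by apply: mem_set; exact: measurableX.
- by apply: mem_set; apply: measurable_above; exact: iV.1.
move=> [w1 w2] [/= W1 W2] [//|j] jn; rewrite big_nat_recl//=.
rewrite {1}/V/=; move: W1; rewrite in_itv/= andbT => W1.
rewrite (eq_big_nat _ _ (F2 := fun i => X i w2)); last first.
  move=> i /andP[_ ij]; have ni : (i.+1 < n.+1)%N by rewrite ltnS (leq_trans ij).
  rewrite /V/= /X2 (insubT (fun i => (i < n.+1)%N) ni)/= rE//=.
  by rewrite subn1.
case: j jn => [|j] jn; first by rewrite big_geq// addr0 (le_lt_trans x0).
have := W2 j.+1; rewrite /= => /(_ jn); lra.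
Qed.

Lemma persistence X n x : 0 <= x -> iid P nu n.+1 X ->
  (forall A : set R, measurable A -> nu (-%R @^-1` A) = nu A) ->
  n.+2%:R * (fine (nu `]x, +oo[%classic) * fine (P (above (- x) X n))) ^+ 2 <= 1.
Proof.
move=> x0 iX nuN; rewrite -lee_fin expr2 !EFinM.
have mA : measurable (above (- x) X n).
  by apply: measurable_above => i ni; apply: iX.1; exact: ltnW.
rewrite !fineK ?fin_num_measure//.
apply: le_trans (persistence_iid iX nuN); rewrite lee_pmul2l// ?lte_fin//.
by apply: lee_pmul; rewrite ?mule_ge0//; exact: above_shift.
Qed.
End persistence.

(** * Gaussian estimates *)

Lemma normal_probN {R : realType} (s : R) (A : set R) : s != 0 -> measurable A ->
  normal_prob 0 s (-%R @^-1` A) = normal_prob 0 s A.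
Proof.
move=> s0 mA; rewrite /normal_prob.
pose opp : measurableTypeR R -> measurableTypeR R := -%R.
have mopp : measurable_fun setT opp by exact: oppr_measurable.
transitivity (\int[lebesgue_measure]_(x in opp @^-1` A)
    (((fun x => (normal_pdf 0 s x)%:E) \o opp) x))%E.
  apply: eq_integral => x _ /=; congr EFin.
  by rewrite normal_pdfE// /normal_fun !subr0 sqrrN.
rewrite -(ge0_integral_pushforward mopp lebesgue_measure)//.
- apply: (@eq_measure_integral _ _ _ _ lebesgue_measure) => B mB _.
  exact: lebesgue_measureN.
- by apply: measurable_funTS; apply/measurable_EFinP; exact: measurable_normal_pdf.
- by move=> x _; rewrite lee_fin normal_pdf_ge0.
Qed.

Lemma normal_prob_le {R : realType} (s a : R) : 0 < s -> 0 <= a ->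
  (normal_prob 0 s `[(- a)%R, a]%classic <= (normal_peak s * (2 * a))%:E)%E.
Proof.
move=> s0 a0; rewrite /normal_prob.
apply: (@le_trans _ _ (\int[lebesgue_measure]_(x in `[(- a)%R, a]) (normal_peak s)%:E)%E).
  apply: ge0_le_integral => //.
  - by move=> x _; rewrite lee_fin normal_pdf_ge0.
  - by apply/measurable_EFinP/measurable_funTS; exact: measurable_normal_pdf.
  - by move=> x _; rewrite lee_fin normal_pdf_ub// gt_eqF.
rewrite integral_cst//= lebesgue_measure_itv/= lte_fin.
case: ifP => _; first by rewrite -EFinB -EFinM lee_fin opprK mulr_natl mulr2n.
by rewrite mule0 lee_fin !mulr_ge0// normal_peak_ge0.
Qed.

(** The interval []s, 2 * s]] has length [s], and on it the exponent [x ^ 2 / (2 * s ^ 2)] is at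
    most 2. *)
Lemma normal_prob_tail_ge {R : realType} (s : R) : 0 < s ->
  ((normal_peak s * s * expR (- 2))%:E <= normal_prob 0 s `]s, +oo[%classic)%E.
Proof.
move=> s0; rewrite /normal_prob.
apply: (@le_trans _ _ (\int[lebesgue_measure]_(x in `]s, (2 * s)%R])
    (normal_pdf 0 s x)%:E)%E); last first.
  apply: ge0_subset_integral => //.
  - by apply/measurable_EFinP/measurable_funTS; exact: measurable_normal_pdf.
  - by move=> x _; rewrite lee_fin normal_pdf_ge0.
  - by move=> x /=; rewrite !in_itv/= => /andP[->].
apply: (@le_trans _ _ (\int[lebesgue_measure]_(x in `]s, (2 * s)%R])
    (normal_peak s * expR (- 2))%:E)%E).
  rewrite integral_cst//= lebesgue_measure_itv/= lte_fin ifT; last lra.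
  by rewrite -EFinB -EFinM lee_fin; lra.
apply: ge0_le_integral => //.
- by move=> x _; rewrite lee_fin mulr_ge0 ?normal_peak_ge0 ?expR_ge0.
- by apply/measurable_EFinP/measurable_funTS; exact: measurable_normal_pdf.
- move=> x /=; rewrite in_itv/= => /andP[sx xs]; rewrite lee_fin.
  rewrite normal_pdfE ?gt_eqF// ler_wpM2l ?normal_peak_ge0// ler_expR subr0.
  rewrite mulNr lerN2 ler_pdivrMr ?pmulrn_lgt0 ?exprn_gt0// mulr2n.
  have : x ^+ 2 <= (2 * s) ^+ 2 by rewrite ler_sqr ?nnegrE//; lra.
  by rewrite exprMn; lra.
Qed.

Lemma normal_peakE {R : realType} (s : R) : 0 < s ->
  normal_peak s = normal_peak 1 / s.
Proof.
move=> s0; rewrite /normal_peak -mulrnAr sqrtrM ?sqr_ge0// sqrtr_sqr gtr0_norm//.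
by rewrite expr1n mul1r invfM mulrC.
Qed.

(** By scaling, [normal_peak s * s] does not depend on [s], so one constant serves all standard
    deviations. *)
Lemma normal_prob_tail_lbound {R : realType} : exists2 c : R, 0 < c &
  forall s : R, 0 < s -> (c%:E <= normal_prob 0 s `]s, +oo[%classic)%E.
Proof.
exists (normal_peak 1 * expR (- 2)).
  by apply: mulr_gt0; [exact: normal_peak_gt0 (oner_neq0 _)|exact: expR_gt0].
move=> s s0; apply: le_trans (normal_prob_tail_ge s0).
by rewrite (normal_peakE s0) divfK// gt_eqF.
Qed.

(** * Brownian motion *)

Section brownian_motion.
Context {d : measure_display} {T : measurableType d} {R : realType}
  {P : probability T R}.

(** Reflection carries lower-level estimates to upper levels, both for [Y] and at the endpoint 1. *)
Lemma is_BMN (B : R -> T -> R) : is_BM P B -> is_BM P (fun t w => - B t w).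
Proof.
move=> [mB B0 cB iB nB]; split.
- by move=> t t0; apply: measurable_funN; exact: mB.
- by move=> w; rewrite B0 oppr0.
- by move=> w x; apply: (@continuousN _ R^o); exact: cB.
- move=> n ts t0 tlt As mAs.
  have mN (A : set R) : measurable A -> measurable (-%R @^-1` A).
    by move=> mA; rewrite -[X in measurable X]setTI; exact: oppr_measurable.
  have := iB n ts t0 tlt (fun i => -%R @^-1` As i) (fun i => mN _ (mAs i)).
  have E i w : - B (ts i.+1) w - - B (ts i) w = - (B (ts i.+1) w - B (ts i) w).
    by rewrite opprB opprK addrC.
  rewrite (_ : [set w | _] = [set w | forall i : 'I_n,
      As i (- B (ts i.+1) w - - B (ts i) w)]); last first.
    by apply/seteqP; split=> w /= H i; have := H i; rewrite E.
  move=> ->; apply: eq_bigr => i _; congr (P _).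
  by apply/seteqP; split=> w /=; rewrite E.
- move=> s t s0 st A mA.
  rewrite -(@normal_probN _ _ A)//; last by rewrite gt_eqF// sqrtr_gt0 subr_gt0.
  rewrite -(nB s t)//; last first.
    by rewrite -[X in measurable X]setTI; exact: oppr_measurable.
  by congr (P _); apply/seteqP; split=> w /=; rewrite opprB opprK addrC.
Qed.

Lemma measurable_cyl (B : R -> T -> R) n (ts : 'I_n -> R) (As : 'I_n -> set R) :
  is_BM P B -> (forall i, 0 <= ts i) -> (forall i, measurable (As i)) ->
  measurable (cyl B ts As).
Proof.
move=> [mB _ _ _ _] ts0 mAs.
by apply: (measurable_rectangle (X := fun i => B (ts i))) => // i; exact: mB.
Qed.

Lemma BM_iid (B : R -> T -> R) (h : R) n : is_BM P B -> 0 < h ->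
  iid P (normal_prob 0 (Num.sqrt h)) n
    (fun i w => B (i.+1%:R * h) w - B (i%:R * h) w).
Proof.
move=> [mB B0 cB iB nB] h0.
have t0 i : 0 <= i%:R * h by rewrite mulr_ge0// ltW.
have tlt i : i%:R * h < i.+1%:R * h by rewrite ltr_pM2r// ltr_nat.
split=> [i _|As mAs]; first by apply: measurable_funB; apply: mB; exact: t0.
rewrite (iB n (fun i => i%:R * h))//; apply: eq_bigr => i _.
have hE : i.+1%:R * h - i%:R * h = h by rewrite -mulrBl -natrB// subSnn mul1r.
by rewrite (nB _ _ (t0 i) (tlt i) _ (mAs i)) hE.
Qed.

(** The random walk bound is applied to [B] sampled on a grid. The event involves finitely many
    times, as the independence hypothesis [indep3] is about cylinders. *)
Lemma BM_persistence : exists2 K : R, 0 < K & forall (B : R -> T -> R) (x s : R),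
  is_BM P B -> 0 < x -> 0 < s ->
  exists n (ts : 'I_n -> R), (forall i, 0 <= ts i <= s) /\
    (P (cyl B ts (fun=> `](- x)%R, +oo[%classic)) <= (K * x / Num.sqrt s)%:E)%E.
Proof.
have [c c_gt0 c_tail] := @normal_prob_tail_lbound R.
exists c^-1 => [|B x s BB x0 s0]; first by rewrite invr_gt0.
(* With this mesh an increment has standard deviation [x], so it exceeds [x] with probability at
   least [c], whatever [x] is. *)
pose h := x ^+ 2; have h0 : 0 < h by rewrite exprn_gt0.
pose n := Num.truncn (s / h).
have sh0 : 0 <= s / h by rewrite divr_ge0// ltW.
have nh : n%:R * h <= s by rewrite -ler_pdivlMr// truncn_le.
have nh2 : s / h < n.+2%:R by rewrite (lt_trans (truncnS_gt _))// ltr_nat.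
pose X i w := B (i.+1%:R * h) w - B (i%:R * h) w.
have iX : iid P (normal_prob 0 (Num.sqrt h)) n.+1 X by exact: BM_iid.
have hx : Num.sqrt h = x by rewrite sqrtr_sqr gtr0_norm.
exists n, (fun i => i.+1%:R * h); split.
  move=> i; rewrite mulr_ge0 ?(ltW h0)//= (le_trans _ nh)// ler_pM2r//.
  by rewrite ler_nat ltn_ord.
have -> : cyl B (fun i : 'I_n => i.+1%:R * h) (fun=> `](- x)%R, +oo[%classic) =
    above (- x) X n.
  have S j w : \sum_(0 <= i < j) X i w = B (j%:R * h) w.
    rewrite (telescope_sumr (fun i => B (i%:R * h) w))//.
    by case: BB => [_ B0 _ _ _]; rewrite mul0r B0 subr0.
  apply/seteqP; split=> w H.
    case=> // j jn; have := H (Ordinal jn).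
    by rewrite S /= in_itv/= andbT.
  by move=> i; have := H i.+1 (ltn_ord i); rewrite S /= in_itv/= andbT.
have mA : measurable (above (- x) X n).
  by apply: measurable_above => i ni; apply: iX.1; exact: ltnW.
have := persistence (ltW x0) iX.
rewrite -(fineK (fin_num_measure P _ mA)) lee_fin.
set p := fine (P _).
have p0 : 0 <= p by rewrite /p fine_ge0.
set q := fine _ => pq.
have cq : c <= q.
  rewrite -lee_fin /q fineK; last by rewrite fin_num_measure.
  by rewrite hx; exact: c_tail.
have {}pq : n.+2%:R * (q * p) ^+ 2 <= 1.
  apply: pq => A mA'; apply: normal_probN => //.
  by rewrite hx gt_eqF.
rewrite -mulrA ler_pdivlMl// ler_pdivlMr ?sqrtr_gt0//.
rewrite -ler_sqr ?nnegrE ?mulr_ge0 ?sqrtr_ge0 ?(ltW x0) ?(ltW c_gt0)//.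
rewrite exprMn sqr_sqrtr; last exact: ltW.
rewrite -/h.
have : s / h * (c * p) ^+ 2 <= 1.
  apply: le_trans pq; apply: ler_pM => //; [exact: sqr_ge0|exact: ltW|].
  rewrite ler_sqr ?nnegrE ?mulr_ge0 ?(ltW c_gt0)//; last exact: le_trans (ltW c_gt0) cq.
  by rewrite ler_wpM2r.
by rewrite mulrAC ler_pdivrMr// mul1r => H; rewrite mulrC.
Qed.

(** Lying in []-a, a[] at the five times [0, t/4, .., t] forces four independent increments into
    [[-2a, 2a]], each with probability [O(a)]. *)
Lemma BM_small_ball (B : R -> T -> R) (a t : R) : is_BM P B -> 0 < a -> 0 < t ->
  exists ts : 'I_5 -> R, (forall i, 0 <= ts i <= t) /\
    (P (cyl B ts (fun=> `](- a)%R, a[%classic)) <=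
     ((4 * normal_peak (Num.sqrt (t / 4)) * a) ^+ 4)%:E)%E.
Proof.
move=> BB a0 t0; pose h := t / 4; have h0 : 0 < h by rewrite divr_gt0.
have [mX iX] := @BM_iid B h 4 BB h0.
have [mB _ _ _ _] := BB.
exists (fun i => i%:R * h); split.
  move=> i; rewrite mulr_ge0 ?(ltW h0)//=.
  have : (i%:R : R) <= 4 by rewrite (ler_nat _ _ 4) -ltnS.
  by rewrite /h => i4; rewrite mulrA ler_pdivrMr// mulrC ler_pM2l.
pose J : set R := `[(- (2 * a))%R, (2 * a)%R]%classic.
have mJ : measurable J by exact: measurable_itv.
apply: (@le_trans _ _ (P [set w | forall i : 'I_4,
    J (B (i.+1%:R * h) w - B (i%:R * h) w)])).
  apply: le_measure.
  - apply: mem_set; apply: (measurable_cyl BB) => i; last exact: measurable_itv.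
    by rewrite mulr_ge0// ltW.
  - apply: mem_set; apply: (measurable_rectangle
      (X := fun (i : 'I_4) w => B (i.+1%:R * h) w - B (i%:R * h) w)
      (As := fun=> J)) => // i.
    exact: mX.
  - move=> w H i.
    have := H (lift ord0 i); have := H (widen_ord (leqnSn 4) i).
    rewrite /J /= !in_itv/= => /andP[? ?] /andP[? ?].
    rewrite /bump/= in H *. lra.
rewrite (iX (fun=> J))// big_const_ord.
have := normal_prob_le (s := Num.sqrt h) (a := 2 * a).
rewrite sqrtr_gt0 => /(_ h0 (mulr_ge0 (ler0n _ 2) (ltW a0))).
rewrite -/J (_ : _ * (2 * (2 * a)) = 4 * normal_peak (Num.sqrt h) * a); last by ring.
set q := normal_prob _ _ _; have q0 : (0 <= q)%E by exact: measure_ge0.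
set b := 4 * _ * a => qb.
suff key m : (0 <= iter m ( *%E q) 1 <= (b ^+ m)%:E)%E by case/andP: (key 4%N).
elim: m => [|m /andP[IH0 IH]]; first by rewrite expr0 lee01 lexx.
by rewrite iterS exprS EFinM mule_ge0//= lee_pmul.
Qed.
End brownian_motion.

(** * Probability that the two-sided motion, read along [Y], stays above a small negative level *)

Section staying_above.
Context {d : measure_display} {T : measurableType d} {R : realType}
  {P : probability T R}.

Lemma BM_hits (Y : R -> T -> R) w s u : is_BM P Y -> 0 <= s ->
  0 <= u <= Y s w \/ Y s w <= u <= 0 -> exists2 c, 0 <= c <= s & Y c w = u.
Proof.
move=> [_ Y0 cY _ _] s0 us.
have [|||c] := @IVT R (fun r => Y r w) 0 s u.
- exact: s0.
- apply: continuous_subspaceW (cY w) => z /=.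
  by rewrite !in_itv/= andbT => /andP[].
- rewrite Y0; case: us => /andP[u1 u2]; rewrite ge_min le_max u1 u2 ?orbT//=.
- by rewrite in_itv/= => c0s cu; exists c.
Qed.

Lemma cyl0 (B : R -> T -> R) (ts : 'I_0 -> R) As : cyl B ts As = setT.
Proof. by apply/seteqP; split=> // w _ []. Qed.

Variables (Xp Xm Y : R -> T -> R).
Hypotheses (bXp : is_BM P Xp) (bXm : is_BM P Xm) (bY : is_BM P Y).
Hypothesis ind : indep3 P Xp Xm Y.

(** A cylinder over no times is the whole space; such cylinders reduce [indep3] to independence of
    two processes. *)
Let none (T' : Type) : 'I_0 -> T' := fun i => match notF (ltn_ord i) with end.

Lemma indep12 n1 n2 (ts1 : 'I_n1 -> R) (ts2 : 'I_n2 -> R) (As1 : 'I_n1 -> set R)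
    (As2 : 'I_n2 -> set R) :
  (forall i, 0 <= ts1 i) -> (forall i, 0 <= ts2 i) ->
  (forall i, measurable (As1 i)) -> (forall i, measurable (As2 i)) ->
  P (cyl Xp ts1 As1 `&` cyl Xm ts2 As2) = (P (cyl Xp ts1 As1) * P (cyl Xm ts2 As2))%E.
Proof.
move=> t1 t2 m1 m2.
have := @ind _ _ 0%N ts1 ts2 (none _) As1 As2 (none _) t1 t2 _ m1 m2.
by rewrite !cyl0 setIT probability_setT mule1; apply; case.
Qed.

Lemma indep13 n1 n3 (ts1 : 'I_n1 -> R) (ts3 : 'I_n3 -> R) (As1 : 'I_n1 -> set R)
    (As3 : 'I_n3 -> set R) :
  (forall i, 0 <= ts1 i) -> (forall i, 0 <= ts3 i) ->
  (forall i, measurable (As1 i)) -> (forall i, measurable (As3 i)) ->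
  P (cyl Xp ts1 As1 `&` cyl Y ts3 As3) = (P (cyl Xp ts1 As1) * P (cyl Y ts3 As3))%E.
Proof.
move=> t1 t3 m1 m3.
have := @ind _ 0%N _ ts1 (none _) ts3 As1 (none _) As3 t1 _ t3 m1.
by rewrite !cyl0 setIT probability_setT mule1; apply => //; case.
Qed.

Lemma indep23 n2 n3 (ts2 : 'I_n2 -> R) (ts3 : 'I_n3 -> R) (As2 : 'I_n2 -> set R)
    (As3 : 'I_n3 -> set R) :
  (forall i, 0 <= ts2 i) -> (forall i, 0 <= ts3 i) ->
  (forall i, measurable (As2 i)) -> (forall i, measurable (As3 i)) ->
  P (cyl Xm ts2 As2 `&` cyl Y ts3 As3) = (P (cyl Xm ts2 As2) * P (cyl Y ts3 As3))%E.
Proof.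
move=> t2 t3 m2 m3.
have := @ind 0%N _ _ (none _) ts2 ts3 (none _) As2 As3 _ t2 t3.
by rewrite !cyl0 setTI probability_setT mul1e; apply => //; case.
Qed.

(* With [x = y ^+ 4] and [e = y ^+ 2]: if [Y] exceeds [e] (resp. goes below [- e])
   before time [t] then [Xp] (resp. [Xm]) stays above [- x] until time [e]. *)
Lemma staying_above_bound (t : R) : 0 < t -> exists K : R,
  forall (y : R) (A : set T), 0 < y <= 1 -> measurable A ->
    A `<=` [set w | forall s, 0 <= s <= t -> - y ^+ 4 < twosided Xp Xm (Y s w) w] ->
    (P A <= (K * y ^+ 5)%:E)%E.
Proof.
move=> t0; have [k k0 pers] := @BM_persistence _ T R P.
pose c : R := 4 * normal_peak (Num.sqrt (t / 4)).
(* The three terms bound [C1] with [C2] (of order [y ^+ 6]), the two mixed cases [C2] with [C4] and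
   [C1] with [C3] (order [y ^+ 5]), and [C5] (order [y ^+ 8]). *)
exists (k ^+ 2 + 2 * k ^+ 2 / Num.sqrt t + c ^+ 4) => y A /andP[y0 y1] mA Asub.
pose x : R := y ^+ 4; pose e : R := y ^+ 2.
have x0 : 0 < x by rewrite exprn_gt0.
have e0 : 0 < e by rewrite exprn_gt0.
have xe : k * x / Num.sqrt e = k * y ^+ 3.
  rewrite sqrtr_sqr gtr0_norm// /x; field; exact: lt0r_neq0.
have [n1 [ts1 [ts1P]]] := pers Xp x e bXp x0 e0.
have [n2 [ts2 [ts2P]]] := pers Xm x e bXm x0 e0.
rewrite xe; set C1 := cyl Xp _ _; set C2 := cyl Xm _ _ => C2P C1P.
have [n3 [ts3 [ts3P]]] := pers Y e t bY e0 t0.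
have [n4 [ts4 [ts4P]]] := pers _ e t (is_BMN bY) e0 t0.
set C3 := cyl Y _ _.
have -> : cyl (fun s w => - Y s w) ts4 (fun=> `](- e)%R, +oo[%classic) =
    cyl Y ts4 (fun=> `]-oo, e[%classic).
  by apply/seteqP; split=> w H i; have := H i; rewrite /= !in_itv/= andbT ltrN2.
set C4 := cyl Y ts4 _ => C4P C3P.
have [ts5 [ts5P]] := BM_small_ball bY e0 t0.
rewrite -/c; set C5 := cyl Y ts5 _ => C5P.
have mit (i : interval R) : measurable [set` i] by exact: measurable_itv.
have ts1_ge0 i : 0 <= ts1 i by case/andP: (ts1P i).
have ts2_ge0 i : 0 <= ts2 i by case/andP: (ts2P i).
have ts3_ge0 i : 0 <= ts3 i by case/andP: (ts3P i).
have ts4_ge0 i : 0 <= ts4 i by case/andP: (ts4P i).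
have ts5_ge0 i : 0 <= ts5 i by case/andP: (ts5P i).
have mC1 : measurable C1 by exact: (measurable_cyl bXp ts1_ge0 (fun=> mit _)).
have mC2 : measurable C2 by exact: (measurable_cyl bXm ts2_ge0 (fun=> mit _)).
have mC3 : measurable C3 by exact: (measurable_cyl bY ts3_ge0 (fun=> mit _)).
have mC4 : measurable C4 by exact: (measurable_cyl bY ts4_ge0 (fun=> mit _)).
have mC5 : measurable C5 by exact: (measurable_cyl bY ts5_ge0 (fun=> mit _)).
have sub : A `<=` ((C1 `&` C2) `|` (C2 `&` C4)) `|` ((C1 `&` C3) `|` C5).
  move=> w /Asub Aw.
  have up s : 0 <= s <= t -> e <= Y s w -> C1 w.
    move=> /andP[s0 st] es i; have /andP[i0 ie] := ts1P i.
    have [|r /andP[r0 rs] Yr] := @BM_hits Y w s (ts1 i) bY s0.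
      by left; rewrite i0 (le_trans ie).
    have := Aw r; rewrite r0 (le_trans rs st) => /(_ isT).
    by rewrite Yr /twosided i0 /= in_itv/= andbT.
  have down s : 0 <= s <= t -> Y s w <= - e -> C2 w.
    move=> /andP[s0 st] es i; have /andP[i0 ie] := ts2P i.
    have [|r /andP[r0 rs] Yr] := @BM_hits Y w s (- ts2 i) bY s0.
      by right; rewrite oppr_le0 i0 andbT (le_trans es)// lerN2.
    have := Aw r; rewrite r0 (le_trans rs st) => /(_ isT).
    rewrite Yr /twosided oppr_ge0 opprK /= in_itv/= andbT.
    (* At time 0 [twosided] reads [Xp], so [Xm] is handled there through its initial value. *)
    case: ifP => // i0'; have -> : ts2 i = 0 by apply/eqP; rewrite eq_le i0' i0.
    by case: bXm => [_ -> _ _ _] _; rewrite oppr_lt0.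
  (* Four cases: [Y] reaches both, one or none of the levels [e] and [- e] before [t]. Reaching a
     level makes [Y] sweep all values from 0 to it. *)
  have [[s [st es]]|nup] := pselect (exists s, 0 <= s <= t /\ e <= Y s w);
  have [[s' [st' es']]|ndown] := pselect (exists s, 0 <= s <= t /\ Y s w <= - e).
  - by left; left; split; [exact: up es|exact: down es'].
  - right; left; split; first exact: up es.
    move=> i; rewrite /= in_itv/= andbT ltNge; apply/negP => es'.
    by apply: ndown; exists (ts3 i).
  - left; right; split; first exact: down es'.
    move=> i; rewrite /= in_itv/= ltNge; apply/negP => es.
    by apply: nup; exists (ts4 i).
  - right; right => i; rewrite /= in_itv/=; apply/andP; split; rewrite ltNge;
      apply/negP => ei; [apply: ndown|apply: nup]; by exists (ts5 i).
apply: (@le_trans _ _ (P (((C1 `&` C2) `|` (C2 `&` C4)) `|` ((C1 `&` C3) `|` C5)))).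
  apply: le_measure => //; apply: mem_set => //.
  by repeat apply: measurableU; try apply: measurableI.
apply: (@le_trans _ _ ((P (C1 `&` C2) + P (C2 `&` C4)) + (P (C1 `&` C3) + P C5))%E).
  apply: le_trans (measureU2 _ _ _) _; try (by repeat apply: measurableU; try apply: measurableI).
  by apply: leeD; apply: measureU2 => //; apply: measurableI.
rewrite indep12// indep23// indep13//.
apply: (@le_trans _ _ (((k * y ^+ 3)%:E * (k * y ^+ 3)%:E +
   (k * y ^+ 3)%:E * (k * e / Num.sqrt t)%:E) +
   ((k * y ^+ 3)%:E * (k * e / Num.sqrt t)%:E + ((c * e) ^+ 4)%:E))%E).
  by repeat apply: leeD; try apply: lee_pmul.
rewrite -!EFinM -!EFinD lee_fin /e.
have y6 : 0 <= k ^+ 2 * (y ^+ 5 - y ^+ 6).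
  by rewrite mulr_ge0 ?sqr_ge0// subr_ge0 ler_wiXn2l// ltW.
have y8 : 0 <= c ^+ 4 * (y ^+ 5 - y ^+ 8).
  by rewrite mulr_ge0 ?exprn_even_ge0// subr_ge0 ler_wiXn2l// ltW.
set r := (Num.sqrt t)^-1; rewrite -subr_ge0.
rewrite (_ : _ - _ = k ^+ 2 * (y ^+ 5 - y ^+ 6) + c ^+ 4 * (y ^+ 5 - y ^+ 8)).
  exact: addr_ge0.
ring.
Qed.
End staying_above.

(** * The survival event *)

(** Freezing the path at its initial value for negative times replaces continuity within a half-line
    by continuity everywhere. *)
Lemma continuous_comp_max0 {R : realType} (f : R -> R) :
  {within `[0, +oo[%classic, continuous f} ->
  continuous ((fun u : R => f (Num.max 0 u)) : R -> R).
Proof.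
move=> /subspace_continuousP cf x.
pose m (u : R) : R := Num.max 0 u.
have m0 u : `[0, +oo[%classic (m u) by rewrite /= in_itv/= andbT le_max lexx.
have cm : continuous m by move=> u; apply: continuous_max; [exact: cst_continuous|exact: cvg_id].
move=> U /(cf _ (m0 x)); rewrite /= => mU.
have : nbhs (m x) [set z : R | `[0, +oo[%classic z -> U (f z)] by exact: mU.
move=> /(cm x); rewrite !nbhs_simpl /=; apply: filterS => z zU; exact/zU/m0.
Qed.

(** The interval is open, so a path inside it up to and including [t] remains there until some
    [t + e]; this makes the inequality for the infimum strict. *)
Lemma exit_time_gtP {R : realType} (z : R -> R) (t : R) : 0 <= t ->
  continuous ((fun s : R => z (Num.max 0 s)) : R -> R) ->
  (t%:E < exit_time `]0%R, 1%R[%classic z)%E <->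
  forall s, 0 <= s <= t -> 0 < z s < 1.
Proof.
move=> t0 cz; split=> [tz s /andP[s0 st]|zt].
  apply: contrapT => zs; move: tz; apply/negP; rewrite -leNgt.
  apply: (@le_trans _ _ s%:E); last by rewrite lee_fin.
  by apply: ereal_inf_lbound; exists s => //=; split=> //; rewrite in_itv.
have : \forall s \near t, 0 < z (Num.max 0 s) < 1.
  have zt01 : `]0, 1[%classic (z (Num.max 0 t)).
    by rewrite /= in_itv/= (max_idPr t0) zt// t0 lexx.
  have : nbhs (z (Num.max 0 t)) `]0, 1[%classic.
    by apply: open_nbhs_nbhs; split=> //; exact: interval_open.
  by move=> /(cz t); rewrite nbhs_simpl /=; apply: filterS => s; rewrite /= in_itv.
move=> /nbhs_ballP[e /= e0 te].
apply: (@lt_le_trans _ _ (t + e)%:E); first by rewrite lte_fin ltrDl.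
apply: le_ereal_inf_tmp => _ [s [s0 zs] <-]; rewrite lee_fin leNgt; apply/negP => ste.
apply: zs; rewrite /= in_itv/=; have [st|ts] := leP s t; first by rewrite zt// s0.
have := te s; rewrite /= (max_idPr s0); apply.
by rewrite /ball/= ltr0_norm ?subr_lt0//; lra.
Qed.

Lemma measurable_bigcap_rat {d} {T : measurableType d} (F : rat -> set T) :
  (forall q, measurable (F q)) -> measurable (\bigcap_q F q).
Proof.
move=> mF; rewrite -[X in measurable X]setCK setC_bigcap; apply: measurableC.
by apply: bigcupT_measurable_rat => q; exact: measurableC.
Qed.

(** The extreme values are attained on [[0, t]], which leaves a positive margin; quantifying it by
    integers keeps the later union countable. *)
Lemma compact_in_unit {R : realType} (z : R -> R) (t : R) : 0 <= t ->
  continuous ((fun s : R => z (Num.max 0 s)) : R -> R) ->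
  (forall s, 0 <= s <= t -> 0 < z s < 1) ->
  exists k : nat, forall s, 0 <= s <= t -> k.+1%:R^-1 <= z s <= 1 - k.+1%:R^-1.
Proof.
move=> t0 cz zt; pose f (s : R) : R := z (Num.max 0 s).
have cf : {within `[0, t], continuous f} by exact: continuous_subspaceT.
have fE s : 0 <= s -> f s = z s by move=> s0; rewrite /f (max_idPr s0).
have [c c0t fc] := EVT_min t0 cf; have [c' c0t' fc'] := EVT_max t0 cf.
have c0 : 0 <= c <= t by move: c0t; rewrite in_itv.
have c0' : 0 <= c' <= t by move: c0t'; rewrite in_itv.
pose m : R := Num.min (z c) (1 - z c').
have m0 : 0 < m.
  by rewrite /m lt_min subr_gt0; case/andP: (zt c c0) => -> _; case/andP: (zt c' c0').
exists (Num.truncn m^-1) => s /[dup] s0t /andP[s0 st].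
have mk : (Num.truncn m^-1).+1%:R^-1 <= m.
  by rewrite invf_ple ?posrE// ltW// truncnS_gt.
have := fc s; have := fc' s; rewrite in_itv/= s0t.
have [c_ge0 _] := andP c0; have [c'_ge0 _] := andP c0'; rewrite !fE//.
move=> /(_ isT) zc' /(_ isT) zc.
rewrite (le_trans mk)//= ?ge_min ?zc//= lerBrDr -lerBrDl.
by rewrite (le_trans mk)// ge_min lerD2l lerN2 zc' orbT.
Qed.

Section iterated_brownian_motion.
Context {d : measure_display} {T : measurableType d} {R : realType}
  {P : probability T R}.
Variables (Xp Xm Y : R -> T -> R).
Hypotheses (bXp : is_BM P Xp) (bXm : is_BM P Xm) (bY : is_BM P Y).

Lemma twosided0 w : twosided Xp Xm 0 w = 0.
Proof. by rewrite /twosided lexx; case: bXp. Qed.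

Lemma continuous_twosided w : continuous ((fun u : R => twosided Xp Xm u w) : R -> R).
Proof.
have [[_ p0 cp _ _] [_ m0 cm _ _]] := (bXp, bXm).
(* Both halves vanish at 0, so the case distinction becomes a sum of continuous functions. *)
rewrite (_ : (fun u => _) = (fun u : R => Xp (Num.max 0 u) w) \+
    ((fun u : R => Xm (Num.max 0 u) w) \o -%R)); last first.
  apply/funext => u /=; rewrite /twosided; have [u0|u0] := leP 0 u.
    by rewrite (max_idPl _) ?oppr_le0// m0 addr0.
  by rewrite (max_idPr _) ?oppr_ge0 ?ltW// p0 add0r.
move=> u; apply: continuousD; first exact: (continuous_comp_max0 (cp w)).
apply: continuous_comp; first exact: oppr_continuous.
exact: (continuous_comp_max0 (cm w)).
Qed.

Lemma continuous_IBM x w :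
  continuous ((fun s : R => IBM Xp Xm Y x (Num.max 0 s) w) : R -> R).
Proof.
have [_ _ cY _ _] := bY.
move=> s; apply: continuousD; first exact: cst_continuous.
apply: (@continuous_comp _ _ _ (fun s : R => Y (Num.max 0 s) w)
  (fun u : R => twosided Xp Xm u w)).
  exact: (continuous_comp_max0 (cY w)).
exact: continuous_twosided.
Qed.

(* Only values at fixed rational times occur on the right-hand side, which makes the
   survival event measurable although [Z] composes two processes. *)
Lemma survivalE (x t : R) w : 0 < x < 1 -> 0 < t ->
  (forall s, 0 <= s <= t -> 0 < IBM Xp Xm Y x s w < 1) <->
  exists k : nat, forall q r : rat, 0 <= (ratr r : R) <= t ->
    0 <= (ratr q : R) < Y (ratr r) w \/ Y (ratr r) w < (ratr q : R) <= 0 ->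
    (k.+1%:R^-1 : R) <= x + twosided Xp Xm (ratr q) w <= 1 - k.+1%:R^-1.
Proof.
move=> x01 t0; split=> [zt|[k Hk] s /andP[s0 st]].
  have [k Hk] := compact_in_unit (ltW t0) (@continuous_IBM x w) zt.
  exists k => q r /andP[r0 rt] qY.
  have [|c /andP[c0 cr] Yc] := @BM_hits _ _ _ _ Y w (ratr r) (ratr q) bY r0.
    by case: qY => /andP[q1 q2]; [left|right];
      apply/andP; split=> //; exact: ltW.
  by have := Hk c; rewrite c0 (le_trans cr rt) /IBM Yc => /(_ isT).
rewrite /IBM; set u := Y s w.
(* No rational lies properly on the way from 0 to [u] when [u = 0]; there the process is at [x],
   inside the interval. *)
have [->|u0] := eqVneq u 0; first by rewrite twosided0 addr0.
suff : k.+1%:R^-1 <= x + twosided Xp Xm u w <= 1 - k.+1%:R^-1.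
  have : 0 < k.+1%:R^-1 :> R by rewrite invr_gt0.
  by move: (_^-1) => i i0 /andP[? ?]; apply/andP; split; lra.
apply: contrapT => nu.
pose Q (v : R) := k.+1%:R^-1 <= x + twosided Xp Xm v w <= 1 - k.+1%:R^-1.
have : \forall v \near u, ~ Q v.
  have clQ : closed [set v | Q v].
    rewrite (_ : [set v | Q v] = (fun v : R => x + twosided Xp Xm v w) @^-1`
        `[k.+1%:R^-1, 1 - k.+1%:R^-1]); last first.
      by apply/seteqP; split=> v; rewrite /= in_itv.
    apply: closed_comp => [v _|]; last exact: interval_closed.
    by apply: continuousD; [exact: cst_continuous|exact: continuous_twosided].
  have oQ : open (~` [set v | Q v]) by rewrite openC.
  by apply: open_nbhs_nbhs; split.
move=> /nbhs_ballP[e /= e0 eQ].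
(* [q] violates the closed bounds like [u] does, and is strictly passed by [Y] at time [s], hence
   also at nearby rational times. *)
have [q qe qu] : exists2 q : rat, `|u - ratr q| < e & 0 <= (ratr q : R) < u \/ u < (ratr q : R) <= 0.
  have [up|un|u0'] := ltgtP 0 u; last by rewrite u0' eqxx in u0.
  - have [q] : exists q : rat, (ratr q : R) \in `]Num.max 0 (u - e), u[.
      by apply: rat_in_itvoo; rewrite gt_max up; lra.
    rewrite in_itv/= gt_max -andbA => /and3P[q0 ueq qu]; exists q.
      by rewrite gtr0_norm ?subr_gt0//; lra.
    by left; rewrite qu ltW.
  - have [q] : exists q : rat, (ratr q : R) \in `]u, Num.min 0 (u + e)[.
      by apply: rat_in_itvoo; rewrite lt_min un; lra.
    rewrite in_itv/= lt_min => /and3P[uq q0 que]; exists q.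
      by rewrite ltr0_norm ?subr_lt0//; lra.
    by right; rewrite uq ltW.
have nQq : ~ Q (ratr q) by apply: eQ.
have [_ _ cY _ _] := bY.
have : \forall s' \near s, 0 <= (ratr q : R) < Y (Num.max 0 s') w \/
    Y (Num.max 0 s') w < (ratr q : R) <= 0.
  have cYs := @continuous_comp_max0 _ _ (cY w) s.
  case: qu => /andP[q1 q2].
  - have : nbhs (Y (Num.max 0 s) w) `]ratr q, +oo[%classic.
      apply: open_nbhs_nbhs; split; first exact: interval_open.
      by rewrite /= in_itv/= andbT (max_idPr s0).
    move=> /cYs; rewrite nbhs_simpl /=; apply: filterS => v.
    by rewrite /= in_itv/= andbT q1 => qv; left.
  - have : nbhs (Y (Num.max 0 s) w) `]-oo, ratr q[%classic.
      apply: open_nbhs_nbhs; split; first exact: interval_open.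
      by rewrite /= in_itv/= (max_idPr s0).
    move=> /cYs; rewrite nbhs_simpl /=; apply: filterS => v.
    by rewrite /= in_itv/= q2 andbT => qv; right.
move=> /nbhs_ballP[h /= h0 hY].
(* Cutting with []0, t[] covers the extreme times [s = 0] and [s = t] too. *)
have [r] : exists r : rat, (ratr r : R) \in `]Num.max 0 (s - h), Num.min t (s + h)[.
  by apply: rat_in_itvoo; rewrite gt_max !lt_min t0; apply/andP; split;
    apply/andP; split; lra.
rewrite in_itv/= gt_max lt_min => /andP[/andP[r0 rsh] /andP[rt rsh']].
apply: nQq; apply: (Hk q r); first by rewrite !ltW.
have := hY (ratr r); rewrite (max_idPr (ltW r0)); apply.
by rewrite /ball/= ltr_norml; lra.
Qed.

Let survival x t := [set w | (t%:E < exit_time `]0%R, 1%R[%classic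
  (fun s => IBM Xp Xm Y x s w))%E].

Lemma survivalP x t w : 0 <= t ->
  survival x t w <-> forall s, 0 <= s <= t -> 0 < IBM Xp Xm Y x s w < 1.
Proof. by move=> t0; apply: exit_time_gtP => //; exact: continuous_IBM. Qed.

Lemma measurable_survival (x t : R) : 0 < x < 1 -> 0 < t -> measurable (survival x t).
Proof.
move=> x01 t0; pose J k : set R := `[k.+1%:R^-1, 1 - k.+1%:R^-1]%classic.
have [mp _ _ _ _] := bXp; have [mm _ _ _ _] := bXm; have [mY _ _ _ _] := bY.
pose C (q r : rat) : set T := (Y (ratr r)) @^-1`
  [set v | 0 <= (ratr q : R) < v \/ v < (ratr q : R) <= 0].
pose D k (q : rat) : set T := (fun w => x + twosided Xp Xm (ratr q) w) @^-1` J k.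
pose F k (q r : rat) : set T := if 0 <= (ratr r : R) <= t then ~` C q r `|` D k q else setT.
have -> : survival x t = \bigcup_k \bigcap_q \bigcap_r F k q r.
  apply/seteqP; split=> w.
    move=> /(survivalP _ _ (ltW t0)) /(survivalE w x01 t0)[k Hk].
    exists k => // q _ r _; rewrite /F; case: ifP => // rt.
    have [qY|] := pselect (C q r w); last by left.
    by right; have := Hk q r rt qY; rewrite /D /J /= in_itv.
  move=> [k _ Hk]; apply/(survivalP _ _ (ltW t0))/(survivalE w x01 t0).
  exists k => q r rt qY; have := Hk q I r I; rewrite /F rt.
  by case=> //; rewrite /D /J /= in_itv.
apply: bigcupT_measurable => k; apply: measurable_bigcap_rat => q.
apply: measurable_bigcap_rat => r; rewrite /F; case: ifP => // /andP[r0 _].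
apply: measurableU.
  apply: measurableC; rewrite /C -[X in measurable X]setTI; apply: mY => //.
  rewrite (_ : [set v | _] = (if 0 <= (ratr q : R) then `]ratr q, +oo[%classic else set0)
      `|` (if (ratr q : R) <= 0 then `]-oo, ratr q[%classic else set0)).
    by apply: measurableU; case: ifP => // _; exact: measurable_itv.
  apply/seteqP; split=> v /=.
    by case=> /andP[q1 q2]; [left; rewrite q1|right; rewrite q2];
      rewrite /= in_itv/= ?andbT.
  by case; case: ifP => // q0; rewrite /= in_itv/= ?andbT => qv;
    [left|right]; rewrite ?andbT.
rewrite /D -[X in measurable X]setTI.
suff : measurable_fun setT (fun w => x + twosided Xp Xm (ratr q) w).
  by apply => //; exact: measurable_itv.
apply: measurable_funD => //; rewrite /twosided.
have [q0|q0] := leP 0 (ratr q : R); first exact: mp.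
by apply: mm; rewrite oppr_ge0 ltW.
Qed.

Lemma ibm_survival_le (x s t : R) : 0 < x < 1 -> 0 < s -> s <= t ->
  ibm_survival P Xp Xm Y t x <= ibm_survival P Xp Xm Y s x.
Proof.
move=> x01 s0 st; have t0 := lt_le_trans s0 st.
have ms := measurable_survival x01 s0; have mt := measurable_survival x01 t0.
apply: fine_le; [exact: fin_num_measure|exact: fin_num_measure|].
apply: le_measure; [exact: (mem_set mt)|exact: (mem_set ms)|] => w.
by rewrite /=; apply: le_lt_trans; rewrite lee_fin.
Qed.

(** Every path starts at [x] and is continuous, so the survival events up to [n.+1%:R^-1] cover the
    whole space; they cannot all be null. *)
Lemma ibm_survival_gt0 (x : R) : 0 < x < 1 ->
  exists2 t : R, 0 < t & 0 < ibm_survival P Xp Xm Y t x.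
Proof.
move=> x01; apply: contrapT => nt.
pose F (n : nat) := survival x n.+1%:R^-1.
have n0 n : 0 < n.+1%:R^-1 :> R by rewrite invr_gt0.
have mF n : measurable (F n) by exact: measurable_survival.
have F0 n : P (F n) = 0%E.
  have f0 : fine (P (F n)) = 0.
    apply/eqP; rewrite eq_le fine_ge0// andbT leNgt; apply/negP => fn.
    by apply: nt; exists n.+1%:R^-1.
  by rewrite -(fineK (fin_num_measure P _ (mF n))) f0.
have FT : \bigcup_n F n = setT.
  apply/seteqP; split=> // w _.
  have : \forall s \near (0 : R), 0 < IBM Xp Xm Y x (Num.max 0 s) w < 1.
    have : nbhs (IBM Xp Xm Y x (Num.max 0 (0 : R)) w) `]0, 1[%classic.
      apply: open_nbhs_nbhs; split; first exact: interval_open.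
      rewrite /= in_itv/= maxxx /IBM; case: bY => [_ -> _ _ _].
      by rewrite twosided0 addr0.
    move=> /(@continuous_IBM x w 0); rewrite nbhs_simpl /=; apply: filterS => s.
    by rewrite /= in_itv.
  move=> /nbhs_ballP[e /= e0 He].
  exists (Num.truncn e^-1) => //; apply/(survivalP _ _ (ltW (n0 _))) => s /andP[s0 se].
  have := He s; rewrite /= (max_idPr s0); apply.
  rewrite /ball/= sub0r normrN ger0_norm// (le_lt_trans se)//.
  by rewrite invf_plt ?posrE// truncnS_gt.
have : (P (\bigcup_n F n) <= \sum_(0 <= n <oo) P (F n))%E.
  have mU : measurable (\bigcup_n F n) by exact: bigcupT_measurable.
  exact: measure_sigma_subadditive.
rewrite FT probability_setT eseries0 => [|n _ _]; last exact: F0.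
by rewrite lee_fin ler10.
Qed.

Lemma ibm_survival_lbound (t : R) : indep3 P Xp Xm Y -> 0 < t -> exists K : R,
  forall y : R, 0 < y <= 1 / 2 -> ibm_survival P Xp Xm Y t (y ^+ 4) <= K * y ^+ 5.
Proof.
move=> ind t0; have [K HK] := staying_above_bound bXp bXm bY ind t0.
exists K => y /andP[y0 y1].
have y01 : 0 < y ^+ 4 < 1 by rewrite exprn_gt0// exprn_ilt1//; lra.
have mS := measurable_survival y01 t0.
rewrite -lee_fin fineK ?fin_num_measure//; apply: HK => //; first by rewrite y0; lra.
move=> w /(survivalP _ _ (ltW t0)) Sw s st.
by have /andP[+ _] := Sw s st; rewrite /IBM; lra.
Qed.

(** Negating [Xp] and [Xm], with [Y] kept, turns staying below 1 from [1 - y ^+ 4] into staying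
    above [- y ^+ 4]. *)
Lemma ibm_survival_ubound (t : R) : indep3 P (fun t w => - Xp t w) (fun t w => - Xm t w) Y ->
  0 < t -> exists K : R, forall y : R, 0 < y <= 1 / 2 ->
  ibm_survival P Xp Xm Y t (1 - y ^+ 4) <= K * y ^+ 5.
Proof.
move=> ind t0; have [K HK] := staying_above_bound (is_BMN bXp) (is_BMN bXm) bY ind t0.
exists K => y /andP[y0 y1].
have y01 : 0 < 1 - y ^+ 4 < 1.
  by rewrite subr_gt0 gtrBl exprn_gt0// exprn_ilt1//; lra.
have mS := measurable_survival y01 t0.
rewrite -lee_fin fineK ?fin_num_measure//; apply: HK => //; first by rewrite y0; lra.
move=> w /(survivalP _ _ (ltW t0)) Sw s st.
have /andP[_] := Sw s st; rewrite /IBM /twosided; case: ifP => _; lra.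
Qed.
End iterated_brownian_motion.

(** * Reflection symmetry and the final contradiction *)

Lemma indep3N {d} {T : measurableType d} {R : realType} (P : probability T R)
    (B1 B2 B3 : R -> T -> R) : indep3 P B1 B2 B3 ->
  indep3 P (fun t w => - B1 t w) (fun t w => - B2 t w) B3.
Proof.
move=> ind n1 n2 n3 ts1 ts2 ts3 As1 As2 As3 t1 t2 t3 m1 m2 m3.
have mN (A : set R) : measurable A -> measurable (-%R @^-1` A).
  by move=> mA; rewrite -[X in measurable X]setTI; exact: oppr_measurable.
exact: (ind _ _ _ ts1 ts2 ts3 (fun i => -%R @^-1` As1 i) (fun i => -%R @^-1` As2 i)
  As3 t1 t2 t3 (fun i => mN _ (m1 i)) (fun i => mN _ (m2 i)) m3).
Qed.

Theorem theorem1p2 (d : measure_display) (T : measurableType d) (R : realType)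
  (P : probability T R) (Xp Xm Y : R -> T -> R) :
  is_BM P Xp -> is_BM P Xm -> is_BM P Y -> indep3 P Xp Xm Y ->
  forall a : R, 0 < a -> ~ satisfies_pde4 a (ibm_survival P Xp Xm Y).
Proof.
move=> bXp bXm bY ind a a0 pde.
have half01 : 0 < (1 / 2 : R) < 1 by apply/andP; split; lra.
(* The rest of the argument takes place at this one time [t]. *)
have [t t0 gt0] := ibm_survival_gt0 bXp bXm bY half01.
have [K1 HK1] := ibm_survival_lbound bXp bXm bY ind t0.
have [K2 HK2] := ibm_survival_ubound bXp bXm bY (indep3N ind) t0.
pose g := ibm_survival P Xp Xm Y; pose K := Num.max K1 K2.
suff : g t (1 / 2) <= 0 by rewrite leNgt gt0.
apply: (@clamped_le0 _ (g t) K).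
- move=> k k4 x; rewrite in_itv/= => x01.
  by have [_ dg _] := pde t x t0 x01; exact: dg.
- move=> x; rewrite in_itv/= => x01.
  have [_ _ gE] := pde t x t0 x01.
  (* The sign of [a] is used here: it transfers the sign of the time derivative to the fourth space
     derivative. *)
  rewrite -(pmulr_rle0 _ a0) [leLHS]gE.
  apply: (@nonincreasing_derive1_le0 _ _ 0) => // [s|s s'].
    by rewrite in_itv/= andbT => s0; have [] := pde s x s0 x01.
  exact: ibm_survival_le.
- by move=> x _; apply: fine_ge0; exact: measure_ge0.
- move=> y /[dup] y12 /andP[y0 _]; apply: le_trans (HK1 y y12) _.
  by apply: ler_wpM2r; [exact/exprn_ge0/ltW|rewrite /K le_max lexx].
- move=> y /[dup] y12 /andP[y0 _]; apply: le_trans (HK2 y y12) _.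
  by apply: ler_wpM2r; [exact/exprn_ge0/ltW|rewrite /K le_max lexx orbT].
Qed.
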